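(* For every non-negative integer $N$, \[\sum_{\pi\in\mathcal{D}_{\le N}} (-1)^{\mathcal{O}(\pi)} q^{\mathcal{E}(\pi)} = \begin{cases}(-q;q^2)_{N/2}, & N \text{ even},\\ 0, & N\text{ odd},\end{cases}\qquad \sum_{\pi\in\mathcal{P}_{\le N}} (-1)^{\mathcal{O}(\pi)} q^{\mathcal{E}(\pi)} = \begin{cases}\dfrac{1}{(q^2;q^2)_{N/2}}, & N \text{ even},\\ 0, & N\text{ odd}.\end{cases}\]
   Context: A partition $\pi=(\lambda_1,\lambda_2,\dots)$ is a finite non-increasing sequence of positive integers; the empty sequence is the unique partition of $0$. $\mathcal{P}_{\le N}$ is the set of partitions with all parts $\le N$, $\mathcal{D}_{\le N}$ the set of partitions into distinct parts all $\le N$. $\mathcal{O}(\pi)=\lambda_1+\lambda_3+\cdots$, $\mathcal{E}(\pi)=\lambda_2+\lambda_4+\cdots$. $(a;q)_l=\prod_{i=0}^{l-1}(1-aq^i)$. Identities of formal power series in $q$. *)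

(* Defs.v *)
From HB Require Import structures.
From mathcomp Require Import all_boot all_order all_algebra.
From mathcomp Require Import boolp classical_sets cardinality fsbigop.

Set Implicit Arguments.
Unset Strict Implicit.
Unset Printing Implicit Defensive.

Import GRing.Theory.

Local Open Scope classical_set_scope.
Local Open Scope ring_scope.

(* The ring R[[q]] of formal power series: coefficient sequences with the
   Cauchy product. *)
Record fps (R : Type) := Fps { fps_coef : nat -> R }.

HB.instance Definition _ (R : Type) := gen_eqMixin (fps R).
HB.instance Definition _ (R : Type) := gen_choiceMixin (fps R).

Lemma fpsP (R : Type) (f g : fps R) : fps_coef f =1 fps_coef g -> f = g.
Proof. by case: f g => [f] [g] /= /funext ->. Qed.

Section FpsRing.
Variable R : comNzRingType.
Implicit Types f g h : fps R.

Definition fps_zero : fps R := Fps (fun=> 0).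
Definition fps_opp f : fps R := Fps (fun n => - fps_coef f n).
Definition fps_add f g : fps R := Fps (fun n => fps_coef f n + fps_coef g n).
Definition fps_one : fps R := Fps (fun n => (n == 0%N)%:R).
Definition fps_mul f g : fps R :=
  Fps (fun n => \sum_(i < n.+1) fps_coef f i * fps_coef g (n - i)).

Lemma fps_addA : associative fps_add.
Proof. by move=> f g h; apply: fpsP => n /=; rewrite addrA. Qed.
Lemma fps_addC : commutative fps_add.
Proof. by move=> f g; apply: fpsP => n /=; rewrite addrC. Qed.
Lemma fps_add0 : left_id fps_zero fps_add.
Proof. by move=> f; apply: fpsP => n /=; rewrite add0r. Qed.
Lemma fps_addN : left_inverse fps_zero fps_opp fps_add.
Proof. by move=> f; apply: fpsP => n /=; rewrite addNr. Qed.

HB.instance Definition _ :=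
  GRing.isZmodule.Build (fps R) fps_addA fps_addC fps_add0 fps_addN.

Definition fps_trunc n f : {poly R} := \poly_(i < n.+1) fps_coef f i.

Lemma coef_fps_trunc n f i : (i <= n)%N -> (fps_trunc n f)`_i = fps_coef f i.
Proof. by move=> le_in; rewrite coef_poly ltnS le_in. Qed.

Lemma fps_coefM_trunc n f g i : (i <= n)%N ->
  fps_coef (fps_mul f g) i = (fps_trunc n f * fps_trunc n g)`_i.
Proof.
move=> le_in; rewrite coefM; apply: eq_bigr => j _.
rewrite !coef_fps_trunc //; first exact: leq_trans (leq_subr _ _) le_in.
by rewrite (leq_trans _ le_in) // -ltnS.
Qed.

Lemma fps_mulC : commutative fps_mul.
Proof.
by move=> f g; apply: fpsP => n; rewrite !(@fps_coefM_trunc n) // mulrC.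
Qed.

Lemma fps_mulA : associative fps_mul.
Proof.
have coef3 f g h n : fps_coef (fps_mul f (fps_mul g h)) n =
    (fps_trunc n f * (fps_trunc n g * fps_trunc n h))`_n.
  rewrite coefM; apply: eq_bigr => j _.
  by rewrite (@fps_coefM_trunc n) ?leq_subr // coef_fps_trunc // -ltnS.
move=> f g h; apply: fpsP => n.
rewrite (fps_mulC (fps_mul f g)) !coef3.
by rewrite mulrA mulrC.
Qed.

Lemma fps_mul1 : left_id fps_one fps_mul.
Proof.
move=> f; apply: fpsP => n /=; rewrite big_ord_recl /= mul1r subn0.
by rewrite big1 ?addr0 // => i _; rewrite mul0r.
Qed.

Lemma fps_mulDl : left_distributive fps_mul fps_add.
Proof.
move=> f g h; apply: fpsP => n /=; rewrite -big_split.
by apply: eq_bigr => i _; rewrite mulrDl.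
Qed.

Lemma fps_one_neq0 : fps_one != fps_zero.
Proof.
by apply/eqP => /(congr1 (fun f => fps_coef f 0))/eqP; rewrite /= oner_eq0.
Qed.

HB.instance Definition _ := GRing.Zmodule_isComNzRing.Build (fps R)
  fps_mulA fps_mulC fps_mul1 fps_mulDl fps_one_neq0.

(* Invertible series are those having an inverse in R[[q]]; following the
   unitRingType convention, f^-1 = f when f is not invertible. *)
Definition fps_unit : pred (fps R) := fun f => `[< exists g, g * f = 1 >].
Definition fps_inv f : fps R :=
  if pselect (exists g, g * f = 1) is left ex then projT1 (cid ex) else f.

Lemma fps_mulVr : {in fps_unit, left_inverse 1 fps_inv *%R}.
Proof.
move=> f /asboolP ex; rewrite /fps_inv; case: pselect => // ex'.
exact: projT2 (cid ex').
Qed.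

Lemma fps_unitP f g : g * f = 1 -> fps_unit f.
Proof. by move=> gf; apply/asboolP; exists g. Qed.

Lemma fps_inv_out : {in [predC fps_unit], fps_inv =1 id}.
Proof.
move=> f; rewrite inE /= => /asboolP nex; rewrite /fps_inv.
by case: pselect.
Qed.

HB.instance Definition _ := GRing.ComNzRing_hasMulInverse.Build (fps R)
  fps_mulVr fps_unitP fps_inv_out.

Fixpoint fps_inv_seq f n : seq R :=
  if n is m.+1 then
    let s := fps_inv_seq f m in
    rcons s (- \sum_(i < m.+1) fps_coef f i.+1 * s`_(m - i))
  else [:: 1].

Lemma unit_fps f : fps_coef f 0 = 1 -> f \is a GRing.unit.
Proof.
move=> f0; pose g := Fps (fun n => (fps_inv_seq f n)`_n).
have szs n : size (fps_inv_seq f n) = n.+1.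
  by elim: n => //= n IHn; rewrite size_rcons IHn.
have nths n k : (k <= n)%N -> (fps_inv_seq f n)`_k = fps_coef g k.
  elim: n => [|n IHn]; first by case: k.
  rewrite leq_eqVlt => /predU1P[-> //|lt_kn].
  by rewrite /= nth_rcons szs lt_kn IHn.
apply/unitrPr; exists g; apply: fpsP => -[|n].
  by rewrite /= big_ord_recl big_ord0 /= f0 mul1r addr0.
change (\sum_(i < n.+2) fps_coef f i * fps_coef g (n.+1 - i) = 0).
have gS : fps_coef g n.+1 =
    - \sum_(i < n.+1) fps_coef f i.+1 * fps_coef g (n - i).
  rewrite {1}/g /= nth_rcons szs ltnn eqxx; congr (- _).
  by apply: eq_bigr => i _; rewrite nths // leq_subr.
by rewrite big_ord_recl f0 mul1r subn0 gS addNr.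
Qed.

Definition fps_q : fps R := Fps (fun n => (n == 1%N)%:R).

(* Sum of a possibly infinite family of formal power series: coefficientwise,
   only finitely many members may contribute. The finiteness clause is needed
   since \sum_(i \in A) is 0 by convention on infinite supports. *)
Definition fps_has_sum (I : choiceType) (A : set I) (F : I -> fps R)
    (S : fps R) : Prop :=
  forall n : nat,
    finite_set [set i | A i /\ fps_coef (F i) n <> 0] /\
    \sum_(i \in A) fps_coef (F i) n = fps_coef S n.

End FpsRing.

Definition qpoch (A : pzRingType) (a q : A) (l : nat) : A :=
  \prod_(i < l) (1 - a * q ^+ i).

Lemma qpoch_q2_unit (R : comNzRingType) (l : nat) :
  qpoch (fps_q R ^+ 2) (fps_q R ^+ 2) l \is a GRing.unit.
Proof.
have q0 (f : fps R) : fps_coef (fps_q R * f) 0 = 0.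
  by rewrite /= big_ord_recl big_ord0 /= mul0r addr0.
apply: rpred_prod => i _; apply: unit_fps.
rewrite expr2 -!mulrA; set f := _ * (_ * _).
change (1 - fps_coef f 0 = 1).
by rewrite q0 subr0.
Qed.

Definition is_partition (s : seq nat) : bool :=
  sorted geq s && all (leq 1) s.

Definition partitions_le (N : nat) : set (seq nat) :=
  [set s | is_partition s /\ all (geq N) s].

Definition distinct_partitions_le (N : nat) : set (seq nat) :=
  [set s | [/\ is_partition s, uniq s & all (geq N) s]].

(* The part lambda_(i+1) is stored at index i. *)
Definition odd_part_sum (s : seq nat) : nat :=
  (\sum_(i < size s | odd i.+1) nth 0 s i)%N.

Definition even_part_sum (s : seq nat) : nat :=
  (\sum_(i < size s | ~~ odd i.+1) nth 0 s i)%N.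

(* Main.v *)
(** Removing the largest part of a partition exchanges the odd-indexed and the
    even-indexed parts. Hence the sums F_N of (-1)^O q^E and G_N of q^O (-1)^E
    over all partitions with parts at most N satisfy
      F_N = F_(N-1) + (-1)^N G_N    and    G_N = G_(N-1) + q^N F_N,
    while for distinct parts the same recursion holds with G_(N-1) and F_(N-1)
    in the last terms. Both systems are solved by induction on N; in the first
    one, odd N gives (1 + q^N) F_N = 0, where 1 + q^N is invertible. *)

Require Import Defs.
From mathcomp Require Import all_boot all_order all_algebra.
From mathcomp Require Import boolp classical_sets cardinality fsbigop.
From mathcomp Require Import zify.

Set Implicit Arguments.
Unset Strict Implicit.
Unset Printing Implicit Defensive.

Import GRing.Theory.

Local Open Scope classical_set_scope.
Local Open Scope ring_scope.

(** * Summable families of formal power series *)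

Section FpsSum.
Variable R : comNzRingType.
Implicit Types (f c S T : fps R).

Lemma fps_coefD f g n : fps_coef (f + g) n = fps_coef f n + fps_coef g n.
Proof. by []. Qed.

Lemma fps_coefN f n : fps_coef (- f) n = - fps_coef f n.
Proof. by []. Qed.

Lemma fps_coefM f g n :
  fps_coef (f * g) n = \sum_(i < n.+1) fps_coef f i * fps_coef g (n - i).
Proof. by []. Qed.

Lemma fps_coefXn k n : fps_coef (fps_q R ^+ k) n = (n == k)%:R.
Proof.
elim: k n => [|k IHk] n; first by rewrite expr0.
rewrite exprS fps_coefM; case: n => [|n].
  by rewrite big_ord_recl big_ord0 /= mul0r addr0.
rewrite big_ord_recl /= mul0r add0r big_ord_recl /= mul1r subSS subn0 IHk eqSS.
by rewrite big1 ?addr0 // => i _; rewrite mul0r.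
Qed.

Lemma fps_coef_sign_eq0 k f n :
  fps_coef f n = 0 -> fps_coef ((-1) ^+ k * f) n = 0.
Proof.
by rewrite -signr_odd mulr_sign; case: (odd k) => //; rewrite fps_coefN => ->;
  rewrite oppr0.
Qed.

Lemma fps_has_sum_unique (I : choiceType) (A : set I) (F : I -> fps R) S T :
  fps_has_sum A F S -> fps_has_sum A F T -> S = T.
Proof.
by move=> hS hT; apply: fpsP => n; rewrite -(hS n).2 -(hT n).2.
Qed.

Lemma fps_has_sum_exists (I : choiceType) (A : set I) (F : I -> fps R) :
  (forall n, finite_set [set i | A i /\ fps_coef (F i) n <> 0]) ->
  exists S, fps_has_sum A F S.
Proof.
by move=> fin; exists (Fps (fun n => \sum_(i \in A) fps_coef (F i) n)).
Qed.

Lemma fps_has_sum1 (I : choiceType) (i : I) (F : I -> fps R) :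
  fps_has_sum [set i] F (F i).
Proof.
move=> n; split; last by rewrite fsbig_set1.
by apply: sub_finite_set (finite_set1 i) => j [].
Qed.

Lemma fps_has_sumU (I : choiceType) (A B : set I) (F : I -> fps R) S T :
  A `&` B `<=` set0 -> fps_has_sum A F S -> fps_has_sum B F T ->
  fps_has_sum (A `|` B) F (S + T).
Proof.
move=> AB0 hA hB n; have [finA sumA] := hA n; have [finB sumB] := hB n.
set A' := [set i | A i /\ _] in finA; set B' := [set i | B i /\ _] in finB.
(* [A] and [B] may be infinite, whereas [fsbigU0] splits a sum over finite sets, so each sum is
   first restricted to its support. *)
have widen C : \sum_(i \in C) fps_coef (F i) n =
    \sum_(i \in [set i | C i /\ fps_coef (F i) n <> 0]) fps_coef (F i) n.
  exact: fsbig_supp.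
have eqU : [set i | (A `|` B) i /\ fps_coef (F i) n <> 0] = A' `|` B'.
  apply/seteqP; split=> i /=; first by move=> [[Ai|Bi] Fi]; [left|right].
  by move=> [[Ai Fi]|[Bi Fi]]; split=> //; [left|right].
rewrite widen eqU; split; first by rewrite finite_setU.
rewrite fsbigU0 //; first by rewrite -!widen sumA sumB.
by move=> i [[Ai _] [Bi _]]; apply: (AB0 i).
Qed.

Lemma fps_has_sum_image (I J : choiceType) (h : I -> J) (A : set I)
    (F : J -> fps R) S :
  injective h -> fps_has_sum A (F \o h) S -> fps_has_sum (h @` A) F S.
Proof.
move=> injh hA n; have [finA sumA] := hA n; split.
  apply: sub_finite_set (finite_image h finA) => _ [[i Ai <-] Fi].
  by exists i.
by rewrite fsbig_image // => i j _ _ /injh.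
Qed.

Lemma fps_has_sumMl (I : choiceType) (A : set I) (F : I -> fps R) c S :
  fps_has_sum A F S -> fps_has_sum A (fun i => c * F i) (c * S).
Proof.
move=> hA n.
(* Coefficient [n] of [c * F i] involves only the coefficients of [F i] up to [n], so every nonzero
   contribution comes from the finite union [X] of their supports. *)
pose X := \bigcup_(j in `I_n.+1) [set i | A i /\ fps_coef (F i) j <> 0].
have finX : finite_set X.
  by apply: bigcup_finite => // j _; case: (hA j).
have XA : X `<=` A by move=> i [j _ []].
have XF i j : A i -> ~ X i -> (j <= n)%N -> fps_coef (F i) j = 0.
  move=> Ai nXi le_jn; apply: contra_notP nXi => Fi.
  by exists j => //=; rewrite ltnS.
have XM i : A i -> ~ X i -> fps_coef (c * F i) n = 0.
  move=> Ai nXi; rewrite fps_coefM big1 // => j _.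
  by rewrite XF ?mulr0 ?leq_subr.
split.
  apply: sub_finite_set finX => i [Ai cFi].
  by apply: contra_notP cFi => nXi; apply: XM.
rewrite -(fsbig_widen X) //; last by move=> i [Ai nXi]; apply: XM.
(* Over the finite [X] the two summations commute; each inner sum then widens back to [A], since [X]
   contains the support of coefficient [n - j]. *)
rewrite fsbig_finite //= exchange_big /=; apply: eq_bigr => j _.
rewrite -mulr_sumr -(hA (n - j)%N).2 -fsbig_finite //; congr (_ * _).
by apply: fsbig_widen => // i [Ai nXi]; apply: XF => //; apply: leq_subr.
Qed.

End FpsSum.

(** * Partitions and their largest part *)

Lemma odd_part_sum_cons x s :
  odd_part_sum (x :: s) = (x + even_part_sum s)%N.
Proof.
by rewrite /odd_part_sum /even_part_sum big_mkcond big_ord_recl /= -big_mkcond.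
Qed.

Lemma even_part_sum_cons x s : even_part_sum (x :: s) = odd_part_sum s.
Proof.
rewrite /odd_part_sum /even_part_sum big_mkcond big_ord_recl /= -big_mkcond /=.
by apply: eq_bigl => i; rewrite negbK.
Qed.

Lemma part_sum_nil : (odd_part_sum [::] = 0%N) * (even_part_sum [::] = 0%N).
Proof. by rewrite /odd_part_sum /even_part_sum !big_ord0. Qed.

(** Each sum is at least its number of terms, so fixing either one bounds the length. Both bounds go
    through one induction because a new head exchanges the two sums. *)
Lemma size_le_part_sum s : all (leq 1) s ->
  (size s <= (odd_part_sum s).*2)%N /\ (size s <= (even_part_sum s).*2.+1)%N.
Proof.
elim: s => [|x s IHs] /=; first by rewrite part_sum_nil.
case/andP=> x_gt0 /IHs[]; rewrite odd_part_sum_cons even_part_sum_cons.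
by split; lia.
Qed.

Lemma finite_bounded_seq N k :
  finite_set [set s : seq nat | (size s <= k)%N /\ all (geq N) s].
Proof.
elim: k => [|k IHk].
  by apply: sub_finite_set (finite_set1 [::]) => -[] // ? ? [].
apply: (@sub_finite_set _ _ ([set [::]] `|`
    [set x :: s | x in `I_N.+1
                & s in [set s | (size s <= k)%N /\ all (geq N) s]])).
  move=> [|x s] /=; first by left.
  by case=> ks /andP[xN sN]; right; exists x => //; exists s.
by rewrite finite_setU; split=> //; apply: finite_image2.
Qed.

Lemma is_partition_cons x s :
  is_partition (x :: s) = [&& (0 < x)%N, all (geq x) s & is_partition s].
Proof.
rewrite /is_partition /= path_sortedE; last by move=> y z t /= yz zt; lia.
by case: (0 < x)%N; rewrite ?andbF ?andbT //= -andbA.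
Qed.

Lemma all_geqS N s : all (geq N) s -> all (geq N.+1) s.
Proof. by apply: sub_all => y; exact: leqW. Qed.

Lemma cons_disjoint (N : nat) (A B : set (seq nat)) :
  (forall s, A s -> all (geq N) s) -> A `&` (cons N.+1 @` B) `<=` set0.
Proof. by move=> AN s [As [t _ ts]]; move: (AN _ As); rewrite -ts /= ltnn. Qed.

Lemma partitions_le0 : partitions_le 0 = [set [::]].
Proof.
apply/seteqP; split=> [[|x s] //|s ->] //=.
by rewrite /partitions_le /= is_partition_cons; case: x => [[]|? []].
Qed.

Lemma distinct_partitions_le0 : distinct_partitions_le 0 = [set [::]].
Proof.
apply/seteqP; split=> [s [ps _ s0]|s ->] //.
by rewrite -partitions_le0.
Qed.

(** A largest part [N.+1] may be repeated, so the tail again ranges over [partitions_le N.+1]; the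
    resulting recursion for the sums is implicit. *)
Lemma partitions_leS N :
  partitions_le N.+1 = partitions_le N `|` cons N.+1 @` partitions_le N.+1.
Proof.
apply/seteqP; split=> [[|x s]|s]; rewrite /partitions_le /=.
- by left.
- rewrite is_partition_cons => -[/and3P[x0 xs ps] /andP[]].
  rewrite leq_eqVlt => /predU1P[->|lt_xN] sN; first by right; exists s.
  left; rewrite /= x0 xs ps -ltnS lt_xN; split=> //=.
  by apply: sub_all xs => y /= /leq_trans; apply; rewrite -ltnS.
- case=> [[ps /all_geqS sN] //|[t [pt tN] <-]].
  by rewrite is_partition_cons tN pt /= tN leqnn.
Qed.

Lemma distinct_partitions_leS N :
  distinct_partitions_le N.+1 =
  distinct_partitions_le N `|` cons N.+1 @` distinct_partitions_le N.
Proof.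
apply/seteqP; split=> [[|x s]|s]; rewrite /distinct_partitions_le /=.
- by left.
- rewrite is_partition_cons => -[/and3P[x0 xs ps] /andP[xNs us] /andP[]].
  (* The head bounds the tail and does not occur in it, so a head [N.+1] leaves a tail bounded by
     [N]. *)
  have lt_s_x : all (gtn x) s.
    apply/allP => y ys /=; rewrite ltn_neqAle; apply/andP.
    by split; [apply: contraNneq xNs => <- | exact: (allP xs)].
  rewrite leq_eqVlt => /predU1P[xE|lt_xN] sN.
    right; exists s; last by rewrite xE.
    by split=> //; apply: sub_all lt_s_x => y; rewrite xE.
  left; rewrite /= x0 xs ps xNs -ltnS lt_xN; split=> //=.
  by apply: sub_all xs => y /= /leq_trans; apply; rewrite -ltnS.
- case=> [[ps us /all_geqS sN] //|[t [pt ut tN] <-]].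
  rewrite is_partition_cons /= (all_geqS tN) pt ut leqnn; split=> //.
  rewrite andbT; apply/negP => Nt.
  by have := allP tN _ Nt; rewrite /= ltnn.
Qed.

(** * The two alternating sums *)

Section Weights.
Variable R : comNzRingType.
Local Notation q := (fps_q R).

(** With both bases as parameters, the two sums are instances of one weight, and removing the
    largest part swaps [a] and [b]. *)
Definition part_weight (a b : fps R) (s : seq nat) : fps R :=
  a ^+ odd_part_sum s * b ^+ even_part_sum s.

Lemma part_weight_nil a b : part_weight a b [::] = 1.
Proof. by rewrite /part_weight !part_sum_nil mulr1. Qed.

Lemma part_weight_cons a b x s :
  part_weight a b (x :: s) = a ^+ x * part_weight b a s.
Proof.
rewrite /part_weight odd_part_sum_cons even_part_sum_cons exprD -mulrA.
by rewrite (mulrC (a ^+ even_part_sum s)).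
Qed.

Lemma has_sum_part_weight_nil a b :
  fps_has_sum [set [::]] (part_weight a b) 1.
Proof. by rewrite -{1}(part_weight_nil a b); exact: fps_has_sum1. Qed.

Lemma has_sum_part_weight_consU a b (N : nat) (A B : set (seq nat)) S T :
  (forall s, A s -> all (geq N) s) ->
  fps_has_sum A (part_weight a b) S -> fps_has_sum B (part_weight b a) T ->
  fps_has_sum (A `|` cons N.+1 @` B) (part_weight a b) (S + a ^+ N.+1 * T).
Proof.
move=> AN hA hB; apply: fps_has_sumU => //; first exact: cons_disjoint.
apply: fps_has_sum_image; first by move=> s t [].
have -> : part_weight a b \o cons N.+1 =
    fun s => a ^+ N.+1 * part_weight b a s.
  by apply: funext => s /=; rewrite part_weight_cons.
exact: fps_has_sumMl.
Qed.

(** The implicit recursion can be used only once the sums at the larger bound are known to exist. A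
    nonzero coefficient [n] forces the exponent of [q] to equal [n], which bounds the length by
    2n+1. *)
Lemma partitions_le_summable N n :
  finite_set [set s | partitions_le N s /\
                      fps_coef (part_weight (-1) q s) n <> 0] /\
  finite_set [set s | partitions_le N s /\
                      fps_coef (part_weight q (-1) s) n <> 0].
Proof.
have bound s : partitions_le N s ->
    (odd_part_sum s = n \/ even_part_sum s = n) ->
    (size s <= n.*2.+1)%N /\ all (geq N) s.
  move=> [/andP[_ /size_le_part_sum[szO szE]] sN] On; split=> //.
  by case: On; lia.
split; apply: sub_finite_set (finite_bounded_seq N n.*2.+1) => s [Ps wn];
  apply: bound => //; [right|left]; apply: contra_notP wn => neq_n.
  rewrite /part_weight fps_coef_sign_eq0 // fps_coefXn.
  by case: eqP => // /esym.
rewrite /part_weight mulrC fps_coef_sign_eq0 // fps_coefXn.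
by case: eqP => // /esym.
Qed.

Lemma qpoch_qS m :
  qpoch (- q) (q ^+ 2) m.+1 =
  qpoch (- q) (q ^+ 2) m + q ^+ m.*2.+1 * qpoch (- q) (q ^+ 2) m.
Proof.
rewrite /qpoch big_ord_recr /= mulNr opprK -exprM mul2n -exprS.
by rewrite mulrDr mulr1 (mulrC _ (q ^+ _)).
Qed.

Lemma qpoch_q2S m :
  qpoch (q ^+ 2) (q ^+ 2) m.+1 =
  qpoch (q ^+ 2) (q ^+ 2) m * (1 - q ^+ m.+1.*2).
Proof. by rewrite /qpoch big_ord_recr /= -exprS -exprM mul2n. Qed.

(** The second sum is the product of 1 + q^k over the odd k up to [N], and [uphalf N] counts these
    k. The recursion couples it to the first sum. *)
Lemma distinct_partitions_le_sums N :
  fps_has_sum (distinct_partitions_le N) (part_weight (-1) q)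
    (if odd N then 0 else qpoch (- q) (q ^+ 2) N./2) /\
  fps_has_sum (distinct_partitions_le N) (part_weight q (-1))
    (qpoch (- q) (q ^+ 2) (uphalf N)).
Proof.
elim: N => [|N [IHF IHG]].
  rewrite distinct_partitions_le0 /qpoch /= big_ord0.
  by split; apply: has_sum_part_weight_nil.
have DN s : distinct_partitions_le N s -> all (geq N) s by case.
have hF := has_sum_part_weight_consU DN IHF IHG.
have hG := has_sum_part_weight_consU DN IHG IHF.
move: hF hG; rewrite -distinct_partitions_leS -[(-1) ^+ _]signr_odd /=.
rewrite uphalf_half; case: ifP => oddN /=; rewrite ?add0n ?add1n.
  by rewrite add0r mul1r mulr0 addr0.
(* For even [N] the two previous sums coincide: they cancel in the first recursion and produce the
   factor 1 + q^(N+1) in the second. *)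
have -> : q ^+ N.+1 = q ^+ N./2.*2.+1 by rewrite -{1}(odd_double_half N) oddN.
by rewrite expr1 mulN1r subrr -qpoch_qS.
Qed.

Lemma unit_1addXn n : 1 + q ^+ n.+1 \is a GRing.unit.
Proof. by apply: unit_fps; rewrite fps_coefD fps_coefXn addr0. Qed.

Lemma partitions_le_sums N :
  fps_has_sum (partitions_le N) (part_weight (-1) q)
    (if odd N then 0 else (qpoch (q ^+ 2) (q ^+ 2) N./2)^-1) /\
  fps_has_sum (partitions_le N) (part_weight q (-1))
    (qpoch (q ^+ 2) (q ^+ 2) N./2)^-1.
Proof.
elim: N => [|N [IHF IHG]].
  rewrite partitions_le0 /qpoch /= big_ord0 invr1.
  by split; apply: has_sum_part_weight_nil.
(* [F] and [G] are so far only known to exist; uniqueness of sums turns the recursion into two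
   linear equations [FE] and [GE] for them. *)
have [F hF] := fps_has_sum_exists (fun n => (partitions_le_summable N.+1 n).1).
have [G hG] := fps_has_sum_exists (fun n => (partitions_le_summable N.+1 n).2).
have PN s : partitions_le N s -> all (geq N) s by case.
have := has_sum_part_weight_consU PN IHF hG.
have := has_sum_part_weight_consU PN IHG hF.
rewrite -partitions_leS -[(-1) ^+ _]signr_odd.
move=> /(fps_has_sum_unique hG) GE /(fps_has_sum_unique hF) FE.
move: hF hG; rewrite /= uphalf_half; move: FE GE.
case oddN: (odd N) => /=; rewrite ?add0n ?add1n.
  rewrite oddN expr0 add0r mul1r => -> GE.
  (* Now [N.+1] is even and [F] equals [G], so [GE] gives the previous value for (1 - q^(N+1)) G,
     and this factor is the next one of the product. *)
  suff -> : G = (qpoch (q ^+ 2) (q ^+ 2) N./2.+1)^-1 by [].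
  have uQ m : qpoch (q ^+ 2) (q ^+ 2) m \is a GRing.unit := qpoch_q2_unit R m.
  have NE : N.+1 = N./2.+1.*2 by rewrite -{1}(odd_double_half N) oddN.
  apply: (mulrI (uQ N./2.+1)); rewrite divrr // qpoch_q2S -mulrA -NE.
  by rewrite mulrBl mul1r {1}GE addrK divrr.
rewrite oddN expr1 mulN1r => FE GE.
(* Now [N.+1] is odd: eliminating [G] leaves (1 + q^(N+1)) F = 0, and then [GE] shows that [G] keeps
   its previous value. *)
have F0 : F = 0.
  apply: (mulrI (unit_1addXn N)); rewrite mulr0 mulrDl mul1r.
  by rewrite {1}FE GE opprD addNKr addNr.
by move: GE; rewrite F0 mulr0 addr0 => ->.
Qed.

End Weights.

Theorem theorem5p1 (N : nat) :
  let q := fps_q int in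
  fps_has_sum (distinct_partitions_le N)
    (fun s => (-1) ^+ odd_part_sum s * q ^+ even_part_sum s)
    (if ~~ odd N then qpoch (- q) (q ^+ 2) (N %/ 2) else 0)
  /\
  fps_has_sum (partitions_le N)
    (fun s => (-1) ^+ odd_part_sum s * q ^+ even_part_sum s)
    (if ~~ odd N then 1 / qpoch (q ^+ 2) (q ^+ 2) (N %/ 2) else 0).
Proof.
rewrite /= !if_neg divn2 div1r.
by split; [case: (distinct_partitions_le_sums int N)
          |case: (partitions_le_sums int N)].
Qed.
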